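(* For every integer $n\ge1$ there exist a constant $C_n>0$ and measures $\mu_{nk}$, $1\le k\le n$, on $\Delta_n$ depending on parameters $w_1,\dots,w_n\in\mathbb{C}$ such that $\int_{t\in\Delta_n}|d\mu_{nk}|\le C_n$ and the following identity holds: $$\langle (w-w_1)\cdots(w-w_n)\rangle=\sum_{k=1}^n\int_{t\in\Delta_n}\langle w-t_1w_1-\dots-t_nw_n\rangle^k\,d\mu_{nk}(w_1,\dots,w_n,t).$$
   Context: For $w\in\mathbb{C}\setminus\{0\}$, $\langle w\rangle:=\overline w/w$ denotes the phase function. $\Delta_n=\{t=(t_1,\dots,t_n): t_j\ge0,\ \sum_j t_j=1\}$ is the standard $(n-1)$-simplex. $|d\mu|$ denotes the total variation of a (signed/complex) measure. *)

(* Defs.v *)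
From HB Require Import structures.
From mathcomp Require Import all_boot all_order all_algebra.
From mathcomp Require Import all_classical all_reals all_analysis.
From mathcomp Require Import complex.

Set Implicit Arguments.
Unset Strict Implicit.
Unset Printing Implicit Defensive.

Import Order.TTheory GRing.Theory Num.Theory.
Local Open Scope classical_set_scope.
Local Open Scope ring_scope.

Section Defs.
Variable R : realType.

(* The standard (n-1)-simplex Delta_n, as a subset of n.-tuple R
   (which carries the product = Borel sigma-algebra). *)
Definition simplex (n : nat) : set (n.-tuple R) :=
  [set t | (forall i : 'I_n, 0 <= tnth t i) /\ \sum_(i < n) tnth t i = 1].

(* phase function <z> = conj z / z  (only used for z <> 0). *)
Definition phase (z : R[i]) : R[i] := conjc z / z.

Definition cabs (z : R[i]) : R := Num.sqrt (complex.Re z ^+ 2 + complex.Im z ^+ 2).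

Definition lincomb (n : nat) (t : n.-tuple R) (w : 'I_n -> R[i]) : R[i] :=
  \sum_(j < n) (real_complex R (tnth t j)) * w j.

(* A complex measure on Delta_n is represented as  h d(nu)  with nu a
   (nonnegative) measure and h a complex density, nu-integrable on Delta_n.
   (Every complex measure is of this form, e.g. nu = |mu|, h = d mu/d|mu|.) *)
Section CMeasure.
Context {d : measure_display} {T : measurableType d}.

Definition cintegrable (nu : {measure set T -> \bar R}) (D : set T)
    (h : T -> R[i]) : Prop :=
  nu.-integrable D (fun x => (complex.Re (h x))%:E) /\
  nu.-integrable D (fun x => (complex.Im (h x))%:E).

Definition cintegral (nu : {measure set T -> \bar R}) (D : set T)
    (f : T -> R[i]) : R[i] :=
  Complex (Rintegral nu D (fun x => complex.Re (f x)))
          (Rintegral nu D (fun x => complex.Im (f x))).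

Definition ctotvar (nu : {measure set T -> \bar R}) (D : set T)
    (h : T -> R[i]) : \bar R :=
  (\int[nu]_(x in D) (cabs (h x))%:E)%E.
End CMeasure.

End Defs.

(* Main.v *)
(* Let u = z - a and v = z - b, let p run through the segment from u to v and put
   K = <u - v>, P = <p>. Since conj p - K p is constant along the segment,
   P = K + E / p with E constant, and sK + (1-s)P has derivative -E v / p^2. Hence
     int_0^1 (k+1) (P - K)^2 (sK + (1-s)P)^k ds = (<u>^(k+1) - K^(k+1)) (<v> - K).
   Expanding both sides in powers of P, the terms free of phases cancel, so that
   <u>^(k+1) <v> is a combination of <u>^(k+1), <v> and of integrals over the segment
   of the powers P^j, 1 <= j <= k+2, with bounded coefficients. The number of points
   is increased one at a time: if a runs through the convex combinations of the old
   points and b is the new point, the segments [a, b] fill the larger simplex. The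
   measures obtained this way all have a density with respect to one probability
   measure on the simplex that does not depend on the points. *)

Require Import Defs.
From HB Require Import structures.
From mathcomp Require Import all_boot all_order all_algebra.
From mathcomp Require Import all_classical all_reals all_analysis.
From mathcomp Require Import complex.
From mathcomp Require Import measurable_realfun.
From mathcomp Require Import ring lra.

Set Implicit Arguments.
Unset Strict Implicit.
Unset Printing Implicit Defensive.

Import Order.TTheory GRing.Theory Num.Theory.
Import numFieldNormedType.Exports.
Import complex.ComplexField.Normc.
Local Open Scope classical_set_scope.
Local Open Scope ring_scope.

Local Notation Re := complex.Re.
Local Notation Im := complex.Im.

(** * Measurability of complex functions through real and imaginary parts *)

Section ComplexMeasurable.
Context {R : realType} {d : measure_display} {T : measurableType d}.
Implicit Types f g : T -> R[i].

Definition cmeasurable f :=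
  measurable_fun setT (fun x => Re (f x)) /\
  measurable_fun setT (fun x => Im (f x)).

Lemma cReD (x y : R[i]) : Re (x + y) = Re x + Re y.
Proof. by case: x; case: y. Qed.

Lemma cImD (x y : R[i]) : Im (x + y) = Im x + Im y.
Proof. by case: x; case: y. Qed.

Lemma cReM (x y : R[i]) : Re (x * y) = Re x * Re y - Im x * Im y.
Proof. by case: x; case: y. Qed.

Lemma cImM (x y : R[i]) : Im (x * y) = Re x * Im y + Im x * Re y.
Proof. by case: x; case: y. Qed.

Lemma complex_ext (x y : R[i]) : Re x = Re y -> Im x = Im y -> x = y.
Proof. by case: x => a b; case: y => c e /= -> ->. Qed.

Lemma cmeasurable_cst (c : R[i]) : cmeasurable (fun=> c).
Proof. by split; exact: measurable_cst. Qed.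

Lemma cmeasurableD f g :
  cmeasurable f -> cmeasurable g -> cmeasurable (fun x => f x + g x).
Proof.
move=> [f1 f2] [g1 g2]; split; under eq_fun do rewrite ?(cReD, cImD);
exact: measurable_funD.
Qed.

Lemma cmeasurableM f g :
  cmeasurable f -> cmeasurable g -> cmeasurable (fun x => f x * g x).
Proof.
move=> [f1 f2] [g1 g2]; split; under eq_fun do rewrite ?(cReM, cImM).
  by apply: measurable_funB; exact: measurable_funM.
by apply: measurable_funD; exact: measurable_funM.
Qed.

Lemma cmeasurableN f : cmeasurable f -> cmeasurable (fun x => - f x).
Proof.
move=> mf; under eq_fun do rewrite -mulN1r.
by apply: cmeasurableM => //; exact: cmeasurable_cst.
Qed.

Lemma cmeasurable_real (r : T -> R) :
  measurable_fun setT r -> cmeasurable (fun x => (r x)%:C%C).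
Proof. by move=> mr; split => //; exact: measurable_cst. Qed.

Lemma cmeasurable_sum (I : Type) (s : seq I) (F : I -> T -> R[i]) :
  (forall i, cmeasurable (F i)) -> cmeasurable (fun x => \sum_(i <- s) F i x).
Proof.
move=> mF; elim: s => [|i s IH].
  by under eq_fun do rewrite big_nil; exact: cmeasurable_cst.
by under eq_fun do rewrite big_cons; exact: cmeasurableD.
Qed.

Lemma cmeasurableX f n : cmeasurable f -> cmeasurable (fun x => f x ^+ n).
Proof.
move=> mf; elim: n => [|n IH]; first exact: cmeasurable_cst.
by under eq_fun do rewrite exprS; exact: cmeasurableM.
Qed.

Lemma cmeasurable_if (b : T -> bool) f g : measurable_fun setT b ->
  cmeasurable f -> cmeasurable g ->
  cmeasurable (fun x => if b x then f x else g x).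
Proof.
move=> mb [f1 f2] [g1 g2]; split.
- rewrite (_ : (fun _ => _) = fun x => if b x then Re (f x) else Re (g x)).
    exact: measurable_fun_ifT.
  by apply/funext => x; case: ifP.
- rewrite (_ : (fun _ => _) = fun x => if b x then Im (f x) else Im (g x)).
    exact: measurable_fun_ifT.
  by apply/funext => x; case: ifP.
Qed.

End ComplexMeasurable.

Lemma cmeasurable_comp (R : realType) d d' (T : measurableType d)
    (T' : measurableType d') (f : T' -> R[i]) (g : T -> T') :
  measurable_fun setT g -> cmeasurable f -> cmeasurable (fun x => f (g x)).
Proof.
move=> mg [f1 f2]; split.
  exact: (measurableT_comp f1).
exact: (measurableT_comp f2).
Qed.

(** * The phase function: explicit formula, measurability, modulus bounds *)

Section Phase.
Context {R : realType}.
Implicit Types z u v : R[i].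

(** Inversion is continuous on the open set of nonzero reals; the point 0, where the inverse is 0 by
    convention, is split off as a separate case. *)
Lemma measurable_invr : measurable_fun [set: R] (fun x : R => x^-1).
Proof.
rewrite (_ : (fun _ => _) = fun x => if x == 0 then 0 else x^-1); last first.
  by apply/funext => x; case: eqVneq => // ->; rewrite invr0.
apply: measurable_fun_if => //.
  by apply: measurable_fun_eqr => //; exact: measurable_cst.
rewrite setTI.
have -> : (fun x : R => x == 0) @^-1` [set false] = [set x | x != 0].
  by apply/seteqP; split => x /=; [move=> -> | move/negbTE].
apply: open_continuous_measurable_fun; first exact: open_neq.
by move=> x; rewrite inE /= => x0; exact: inv_continuous.
Qed.

(** Rational in the real and imaginary parts, which gives measurability. It also holds at 0, where
    both sides are 0 by the convention on inverses. *)
Lemma phaseE z : phase z =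
  Complex ((Re z ^+ 2 - Im z ^+ 2) * (Re z ^+ 2 + Im z ^+ 2)^-1)
          (- (2 * Re z * Im z) * (Re z ^+ 2 + Im z ^+ 2)^-1).
Proof.
case: z => a b; rewrite /phase /= ; apply/eqP; rewrite eq_complex /=.
by apply/andP; split; apply/eqP; ring.
Qed.

Lemma normc_ReIm z : normc z = Num.sqrt (Re z ^+ 2 + Im z ^+ 2).
Proof. by case: z. Qed.

Lemma phaseM u v : phase (u * v) = phase u * phase v.
Proof. by rewrite /phase rmorphM invfM mulrACA. Qed.

Lemma normc_conjc z : normc (conjc z) = normc z.
Proof. by case: z => a b /=; rewrite sqrrN. Qed.

(** The modulus is 1 except at 0, where the phase is 0; hence only an inequality. *)
Lemma normc_phase_le1 z : normc (phase z) <= 1.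
Proof.
rewrite /phase normcM.
rewrite normcV normc_conjc.
have [->|z0] := eqVneq (normc z) 0; first by rewrite mul0r.
by rewrite divff.
Qed.

Lemma cmeasurable_phase d (T : measurableType d) (f : T -> R[i]) :
  cmeasurable f -> cmeasurable (fun x => phase (f x)).
Proof.
move=> [f1 f2]; under eq_fun do rewrite phaseE.
have h : measurable_fun setT (fun x => (Re (f x) ^+ 2 + Im (f x) ^+ 2)^-1).
  apply: (measurableT_comp measurable_invr).
  by apply: measurable_funD; exact: measurable_funX.
split => /=; apply: measurable_funM => //.
  by apply: measurable_funB; exact: measurable_funX.
apply: measurable_funN; apply: measurable_funM => //.
by apply: measurable_funM => //; exact: measurable_cst.
Qed.

Lemma normr_Re_le z : `|Re z| <= normc z.
Proof.
case: z => a b /=; rewrite -sqrtr_sqr ler_wsqrtr// lerDl sqr_ge0 //.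
Qed.

Lemma normr_Im_le z : `|Im z| <= normc z.
Proof.
case: z => a b /=; rewrite -sqrtr_sqr ler_wsqrtr// lerDr sqr_ge0 //.
Qed.

Lemma normc_le_ReIm z : normc z <= `|Re z| + `|Im z|.
Proof.
case: z => a b /=; rewrite -[leRHS]ger0_norm ?addr_ge0// -sqrtr_sqr.
rewrite ler_wsqrtr// sqrrD !real_normK ?num_real// addrAC lerDl.
by rewrite mulrn_wge0// mulr_ge0.
Qed.

Lemma normc_ge0 z : 0 <= normc z.
Proof. by case: z => a b; exact: sqrtr_ge0. Qed.

End Phase.

(** * Bounded measurable families and their closure properties *)

Section BoundedMeasurable.
Context {R : realType} {d : measure_display} {T : measurableType d}.
Implicit Types f g : T -> R[i].

(* Bounded uniformly in the parameter [w] as well: this is what makes the bound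
   on the total variations independent of the points. *)
Definition ubm (W : Type) (F : W -> T -> R[i]) :=
  (exists M, forall w x, normc (F w x) <= M) /\ forall w, cmeasurable (F w).

Definition bm f := (exists M, forall x, normc (f x) <= M) /\ cmeasurable f.

Lemma ubm_bm (W : Type) (F : W -> T -> R[i]) w : ubm F -> bm (F w).
Proof. by move=> [[M hM] mF]; split => //; exists M. Qed.

Lemma ubm_cst (W : Type) (c : W -> R[i]) M : (forall w, normc (c w) <= M) ->
  ubm (fun w (_ : T) => c w).
Proof. by move=> cM; split=> [|w]; [exists M|exact: cmeasurable_cst]. Qed.

Lemma ubm_const (W : Type) (c : R[i]) : ubm (fun (_ : W) (_ : T) => c).
Proof. exact: (ubm_cst (M := normc c)). Qed.

Lemma ubmD (W : Type) (F G : W -> T -> R[i]) :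
  ubm F -> ubm G -> ubm (fun w x => F w x + G w x).
Proof.
move=> [[M hM] mF] [[N hN] mG]; split=> [|w]; last exact: cmeasurableD.
exists (M + N) => w x.
by rewrite (le_trans (le_normcD _ _))// lerD.
Qed.

Lemma ubmM (W : Type) (F G : W -> T -> R[i]) :
  ubm F -> ubm G -> ubm (fun w x => F w x * G w x).
Proof.
move=> [[M hM] mF] [[N hN] mG]; split=> [|w]; last exact: cmeasurableM.
exists (M * N) => w x.
by rewrite normcM ler_pM// normc_ge0.
Qed.

Lemma ubm_sum (W : Type) (I : Type) (s : seq I) (F : I -> W -> T -> R[i]) :
  (forall i, ubm (F i)) -> ubm (fun w x => \sum_(i <- s) F i w x).
Proof.
move=> bF; elim: s => [|i s IH].
  by under eq_fun do under eq_fun do rewrite big_nil; exact: ubm_const.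
by under eq_fun do under eq_fun do rewrite big_cons; exact: ubmD.
Qed.

Lemma ubmX (W : Type) (F : W -> T -> R[i]) n :
  ubm F -> ubm (fun w x => F w x ^+ n).
Proof.
move=> bF; elim: n => [|n IH]; first exact: ubm_const.
by under eq_fun do under eq_fun do rewrite exprS; exact: ubmM.
Qed.

Lemma ubm_if (W : Type) (b : T -> bool) (F G : W -> T -> R[i]) :
  measurable_fun setT b ->
  ubm F -> ubm G -> ubm (fun w x => if b x then F w x else G w x).
Proof.
move=> mb [[M hM] mF] [[N hN] mG]; split=> [|w]; last exact: cmeasurable_if.
by exists (Num.max M N) => w x; rewrite le_max; case: ifP; rewrite ?hM ?hN ?orbT.
Qed.

Lemma ubm_phase (W : Type) (F : W -> T -> R[i]) :
  (forall w, cmeasurable (F w)) -> ubm (fun w x => phase (F w x)).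
Proof.
move=> mF; split=> [|w]; last exact: cmeasurable_phase.
by exists 1 => w x; exact: normc_phase_le1.
Qed.

(** A single function is a family over [unit], so the closure properties of [bm] follow from those
    of [ubm]. *)
Lemma bm_ubm f : bm f -> ubm (fun _ : unit => f).
Proof. by move=> [[M hM] mf]; split => //; exists M. Qed.

Lemma bmD f g : bm f -> bm g -> bm (fun x => f x + g x).
Proof. by move=> /bm_ubm bf /bm_ubm bg; exact: (ubm_bm tt (ubmD bf bg)). Qed.

Lemma bmM f g : bm f -> bm g -> bm (fun x => f x * g x).
Proof. by move=> /bm_ubm bf /bm_ubm bg; exact: (ubm_bm tt (ubmM bf bg)). Qed.

Lemma bmX f n : bm f -> bm (fun x => f x ^+ n).
Proof. by move=> /bm_ubm bf; exact: (ubm_bm tt (ubmX n bf)). Qed.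

Lemma bm_sum (I : Type) (s : seq I) (F : I -> T -> R[i]) :
  (forall i, bm (F i)) -> bm (fun x => \sum_(i <- s) F i x).
Proof.
move=> bF; have {}bF i : ubm (fun _ : unit => F i) by exact: bm_ubm.
exact: (ubm_bm tt (ubm_sum s bF)).
Qed.

Lemma bm_cst c : bm (fun _ : T => c).
Proof. by split; [exists (normc c)|exact: cmeasurable_cst]. Qed.

Lemma bm_phase f : cmeasurable f -> bm (fun x => phase (f x)).
Proof. by move=> mf; exact: (ubm_bm tt (ubm_phase (fun=> mf))). Qed.

End BoundedMeasurable.

Lemma ubm_comp (R : realType) d d' (T : measurableType d)
    (T' : measurableType d') (W W' : Type) (F : W -> T -> R[i]) (g : W' -> W)
    (p : T' -> T) :
  measurable_fun setT p -> ubm F -> ubm (fun w x => F (g w) (p x)).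
Proof.
move=> mp [[M hM] mF]; split=> [|w]; first by exists M.
exact: (cmeasurable_comp mp).
Qed.

Lemma bm_comp (R : realType) d d' (T : measurableType d)
    (T' : measurableType d') (f : T -> R[i]) (p : T' -> T) :
  measurable_fun setT p -> bm f -> bm (fun x => f (p x)).
Proof. by move=> mp /bm_ubm /(ubm_comp id mp)/(ubm_bm tt). Qed.

(** * Linearity of the complex integral on a set of finite measure *)

Section ComplexIntegral.
Context {R : realType} {d : measure_display} {T : measurableType d}.
Variables (mu : {measure set T -> \bar R}) (D : set T).
Hypotheses (mD : measurable D) (muD : (mu D < +oo)%E).
Implicit Types f g : T -> R[i].

Lemma bounded_integrable (f : T -> R) M : measurable_fun setT f ->
  (forall x, `|f x| <= M) -> mu.-integrable D (EFin \o f).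
Proof.
move=> mf fM; apply: measurable_bounded_integrable => //.
  exact: measurable_funTS.
exists M; split; first exact: num_real.
by move=> x Mx t _ /=; rewrite (le_trans (fM t))// ltW.
Qed.

Lemma bm_cintegrable f : bm f -> cintegrable mu D f.
Proof.
move=> [[M hM] [m1 m2]]; split; apply: bounded_integrable (M) _ _ => // x.
  exact: le_trans (normr_Re_le _) (hM x).
exact: le_trans (normr_Im_le _) (hM x).
Qed.

Lemma eq_cintegral f g : (forall x, D x -> f x = g x) ->
  cintegral mu D f = cintegral mu D g.
Proof.
move=> fg; rewrite /cintegral; congr Complex; apply: eq_Rintegral => x;
by rewrite inE => /fg ->.
Qed.

Lemma cintegralD f g : bm f -> bm g ->
  cintegral mu D (fun x => f x + g x) = cintegral mu D f + cintegral mu D g.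
Proof.
move=> /bm_cintegrable[f1 f2] /bm_cintegrable[g1 g2].
rewrite /cintegral; apply: complex_ext; rewrite /= -RintegralD//;
by apply: eq_Rintegral => x _; rewrite ?cReD ?cImD.
Qed.

Lemma cintegralZl c f : bm f ->
  cintegral mu D (fun x => c * f x) = c * cintegral mu D f.
Proof.
move=> /bm_cintegrable[f1 f2].
have i1 (r : R) : mu.-integrable D (EFin \o fun x => r * Re (f x)).
  by rewrite (_ : _ \o _ = fun x => r%:E * (Re (f x))%:E)%E//; exact: integrableZl.
have i2 (r : R) : mu.-integrable D (EFin \o fun x => r * Im (f x)).
  by rewrite (_ : _ \o _ = fun x => r%:E * (Im (f x))%:E)%E//; exact: integrableZl.
apply: complex_ext; rewrite ?cReM ?cImM /cintegral /= -!RintegralZl//.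
  by rewrite -RintegralB//; apply: eq_Rintegral => x _; rewrite cReM.
by rewrite -RintegralD//; apply: eq_Rintegral => x _; rewrite cImM.
Qed.

Lemma cintegralZr c f : bm f ->
  cintegral mu D (fun x => f x * c) = cintegral mu D f * c.
Proof.
move=> bf; rewrite mulrC -cintegralZl//.
by apply: eq_cintegral => x _; rewrite mulrC.
Qed.

Lemma cintegral0 : cintegral mu D (fun=> 0) = 0.
Proof.
by apply: complex_ext => /=; rewrite Rintegral_cst// mul0r.
Qed.

Lemma cintegral_sum (I : Type) (s : seq I) (F : I -> T -> R[i]) :
  (forall i, bm (F i)) ->
  cintegral mu D (fun x => \sum_(i <- s) F i x) =
  \sum_(i <- s) cintegral mu D (F i).
Proof.
move=> bF; elim: s => [|i s IH].
  by rewrite big_nil -[RHS]cintegral0; apply: eq_cintegral => x _; rewrite big_nil.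
rewrite big_cons -IH -cintegralD//; last exact: bm_sum.
by apply: eq_cintegral => x _; rewrite big_cons.
Qed.

(** Serves to discard the points where a phase of 0 occurs and the endpoints of segments. *)
Lemma ae_eq_cintegral (N : set T) f g :
  cmeasurable f -> cmeasurable g -> measurable N ->
  mu N = 0%E -> (forall x, D x -> ~ N x -> f x = g x) ->
  cintegral mu D f = cintegral mu D g.
Proof.
move=> [f1 f2] [g1 g2] mN N0 fg.
apply: complex_ext => /=; congr fine; apply: ae_eq_integral => //;
  try by apply/measurable_EFinP; exact: measurable_funTS.
- exists N; split => // x /= h; apply: contrapT => Nx; apply: h => Dx.
  by rewrite fg.
- exists N; split => // x /= h; apply: contrapT => Nx; apply: h => Dx.
  by rewrite fg.
Qed.

End ComplexIntegral.

(** * Complex integrals against probability measures *)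

Section ProbabilityIntegral.
Context {R : realType} {d : measure_display} {T : measurableType d}.
Variable (P : probability T R).
Implicit Types f g : T -> R[i].

Lemma probability_lty : (P setT < +oo)%E.
Proof. by rewrite probability_setT ltry. Qed.

Lemma cintegral_probability_cst c : cintegral P setT (fun=> c) = c.
Proof.
by apply: complex_ext => /=; rewrite Rintegral_cst//= probability_setT mulr1.
Qed.

(** Real and imaginary parts are bounded separately by [M]; the lost factor is harmless, since only
    some uniform bound is wanted. *)
Lemma normc_cintegral_le f M : bm f -> (forall x, normc (f x) <= M) ->
  normc (cintegral P setT f) <= M + M.
Proof.
move=> bf fM; have [i1 i2] := bm_cintegrable measurableT probability_lty bf.
have iM : P.-integrable setT (EFin \o fun=> M).
  exact: finite_measure_integrable_cst.
have RM : \int[P]_(x in setT) M = M.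
  by rewrite Rintegral_cst//= probability_setT mulr1.
apply: le_trans (normc_le_ReIm _) _; apply: lerD => /=.
  rewrite (le_trans (le_normr_Rintegral _ i1))// -RM; apply: le_Rintegral => //.
    exact: (integrable_abse i1).
  by move=> x _; exact: le_trans (normr_Re_le _) (fM x).
rewrite (le_trans (le_normr_Rintegral _ i2))// -RM; apply: le_Rintegral => //.
  exact: (integrable_abse i2).
by move=> x _; exact: le_trans (normr_Im_le _) (fM x).
Qed.

Lemma cintegral_distribution d' (T' : measurableType d') (X : {mfun T >-> T'})
    (f : T' -> R[i]) : bm f ->
  cintegral (distribution P X) setT f = cintegral P setT (fun x => f (X x)).
Proof.
move=> bf; have [_ [m1 m2]] := bf.
have [i1 i2] := bm_cintegrable measurableT probability_lty
  (bm_comp (measurable_funPT X) bf).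
apply: complex_ext => /=; congr fine; apply: integral_distribution => //;
exact/measurable_EFinP.
Qed.

End ProbabilityIntegral.

(** * Iterated complex integrals *)

Section Fubini.
Context {R : realType} {d1 d2 : measure_display}.
Context {T1 : measurableType d1} {T2 : measurableType d2}.
Variables (P1 : probability T1 R) (P2 : probability T2 R).

Lemma bm_cintegral2 (f : T1 * T2 -> R[i]) : bm f ->
  bm (fun x => cintegral P2 setT (fun y => f (x, y))).
Proof.
move=> bf; have bfx x : bm (fun y => f (x, y)).
  exact: (bm_comp (measurable_pair1 x)).
have [[M hM] [m1 m2]] := bf.
have [i1 i2] := bm_cintegrable measurableT (probability_lty (P1 \x P2)%E) bf.
split; first by exists (M + M) => x; apply: normc_cintegral_le.
split => /=.
  apply: (measurableT_comp (fine_measurable measurableT)).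
  exact: (measurable_fubini_F i1).
apply: (measurableT_comp (fine_measurable measurableT)).
exact: (measurable_fubini_F i2).
Qed.

Lemma cintegral_prod (f : T1 * T2 -> R[i]) : bm f ->
  cintegral (P1 \x P2)%E setT f =
  cintegral P1 setT (fun x => cintegral P2 setT (fun y => f (x, y))).
Proof.
move=> bf; have bfx x : bm (fun y => f (x, y)).
  exact: (bm_comp (measurable_pair1 x)).
have [i1 i2] := bm_cintegrable measurableT (probability_lty (P1 \x P2)%E) bf.
have ix x := bm_cintegrable measurableT (probability_lty P2) (bfx x).
apply: complex_ext => /=; congr fine; rewrite -integral12_prod_meas1//;
  apply: eq_integral => x _; rewrite /fubini_F /= fineK//;
  apply: integrable_fin_num => //; by have [] := ix x.
Qed.

End Fubini.

Definition mfun_of d d' (T : measurableType d)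
    (T' : measurableType d') (f : T -> T') (mf : measurable_fun setT f) :
    {mfun T >-> T'} :=
  MeasurableFun.Pack (MeasurableFun.Class (isMeasurableFun.Build _ _ _ _ f mf)).

(** * A probability on [0, 1] with atoms at both endpoints *)

Section ClampedUniform.
Context {R : realType}.
Local Notation leb := (@lebesgue_measure R).

Definition clamp (x : R) : R := Num.max 0 (Num.min x 1).

Lemma measurable_clamp : measurable_fun setT clamp.
Proof.
by apply: measurable_maxr => //; exact: measurable_minr.
Qed.

Lemma clamp01 x : 0 <= clamp x <= 1.
Proof. by rewrite /clamp le_max lexx ge_max ler01 ge_min lexx orbT. Qed.

Lemma ltN12 : -1 < 2 :> R.
Proof. lra. Qed.

(* Clamping spreads mass 1/3 uniformly on [0, 1] and puts an atom of mass 1/3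
   at each endpoint. *)
Definition clamped_uniform : probability R R :=
  distribution (uniform_prob ltN12)
    (mfun_of (measurable_clamp : measurable_fun (T := measurableTypeR R) setT clamp)).

Lemma Rintegral_uniform (a b : R) (ab : a < b) (g : R -> R) M :
  measurable_fun setT g -> (forall x, `|g x| <= M) ->
  \int[uniform_prob ab]_(x in setT) g x =
  (b - a)^-1 * \int[leb]_(x in `[a, b]) g x.
Proof.
move=> mg gM; have mEg : measurable_fun setT (EFin \o g) by exact/measurable_EFinP.
have lab : (leb `[a, b]%classic < +oo)%E.
  by rewrite lebesgue_measure_itv /=; case: ifP => // _; rewrite -EFinB ltry.
have ig : leb.-integrable `[a, b] (EFin \o g).
  exact: (bounded_integrable _ lab mg gM).
(* The density formula is applied to the positive and negative parts; their difference may be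
   factored because both integrals are finite. *)
rewrite /Rintegral; rewrite [X in fine X = _]integralE.
rewrite !integral_uniform//; [|exact: measurable_funeneg|exact: measurable_funepos].
rewrite -muleBr ?fin_numE//; last first.
  apply: fin_num_adde_defr; apply: integrable_fin_num => //.
  exact: integrable_funepos.
by rewrite -integralE fineM//; exact: integrable_fin_num.
Qed.

Lemma Rintegral_clamp (g : R -> R) M :
  measurable_fun setT g -> (forall x, `|g x| <= M) ->
  \int[leb]_(x in `[-1, 2]) g (clamp x) =
  g 0 + g 1 + \int[leb]_(x in `[0, 1]) g x.
Proof.
move=> mg gM.
have mgc : measurable_fun setT (g \o clamp).
  exact: measurableT_comp mg measurable_clamp.
have iab (a b : R) : leb.-integrable `[a, b] (EFin \o (g \o clamp)).
  have lab : (leb `[a, b]%classic < +oo)%E; last first.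
    exact: (bounded_integrable _ lab mgc (fun x => gM _)).
  by rewrite lebesgue_measure_itv /=; case: ifP => // _; rewrite -EFinB ltry.
(* The interval [-1, 2] is cut at 1, then [-1, 1] at 0. On the two outer pieces, each of length 1,
   [clamp] is constant. *)
have H1 := @Rintegral_itvB R (g \o clamp) (BLeft (-1)) (BRight 2) 1 (iab _ _).
have H0 := @Rintegral_itvB R (g \o clamp) (BLeft (-1)) (BRight 1) 0 (iab _ _).
have {H1} := H1 ltac:(rewrite bnd_simp; lra) ltac:(rewrite bnd_simp; lra).
have {H0} := H0 ltac:(rewrite bnd_simp; lra) ltac:(rewrite bnd_simp; lra).
rewrite (@Rintegral_itv_obnd_cbnd R 0); last first.
  apply: integrableS (iab 0 1) => //; apply: subset_itvr.
  by rewrite bnd_simp.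
rewrite [X in _ - X = _](_ : _ = g 0); last first.
  under eq_Rintegral => x.
    rewrite inE /= in_itv /= => /andP[_ x0].
    rewrite (_ : clamp x = 0); first over.
    by rewrite /clamp min_l ?max_l// (le_trans x0).
  rewrite Rintegral_cst//= lebesgue_measure_itv/= lte_fin.
  by rewrite ltrN10 /= sub0r opprK mulr1.
rewrite [X in _ = X -> _ -> _](_ : _ = \int[leb]_(x in `[0, 1]) g x); last first.
  apply: eq_Rintegral => x; rewrite inE /= in_itv /= => /andP[x0 x1].
  by rewrite /clamp min_l// max_r.
move=> H0; rewrite [X in _ = X -> _](_ : _ = g 1); last first.
  under eq_Rintegral => x.
    rewrite inE /= in_itv /= => /andP[x1 _].
    rewrite (_ : g (clamp x) = g 1); first over.
    by rewrite /clamp min_r ?max_r// ltW.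
  rewrite Rintegral_cst//= lebesgue_measure_itv/= lte_fin.
  by rewrite ltr1n /= (_ : 2 - 1 = 1 :> R) ?mulr1//; lra.
rewrite /comp in H0 * => H1; lra.
Qed.

(** The atoms supply the endpoint values, which are needed to produce the boundary terms of the
    segment identity; the rest is Lebesgue measure. *)
Lemma cintegral_clamped_uniform (f : R -> R[i]) : bm f ->
  cintegral clamped_uniform setT f =
  (f 0 + f 1 + cintegral leb `[0, 1] f) / 3%:R.
Proof.
move=> bf; rewrite cintegral_distribution//; have [[M hM] [m1 m2]] := bf.
have RM x : `|Re (f x)| <= M by exact: le_trans (normr_Re_le _) (hM x).
have IM x : `|Im (f x)| <= M by exact: le_trans (normr_Im_le _) (hM x).
have mc (g : R -> R) : measurable_fun setT g -> measurable_fun setT (g \o clamp).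
  by move=> mg; exact: measurableT_comp mg measurable_clamp.
have -> : (3%:R : R[i])^-1 = (3%:R^-1)%:C%C by rewrite fmorphV rmorph_nat.
apply: complex_ext; rewrite /cintegral /=.
  rewrite (@Rintegral_uniform _ _ _ _ M)// ?(Rintegral_clamp m1 RM); last first.
    exact: (mc _ m1).
  rewrite cReM !cReD /= mulr0 subr0 mulrC; congr (_ * _^-1); lra.
rewrite (@Rintegral_uniform _ _ _ _ M)// ?(Rintegral_clamp m2 IM); last first.
  exact: (mc _ m2).
rewrite cImM !cImD /= mulr0 add0r mulrC; congr (_ * _^-1); lra.
Qed.

(** The preimage of such a point under [clamp] lies in the point itself, which is null for the
    uniform law. This will show that convex combinations hit [z] with probability 0. *)
Lemma clamped_uniform_set1 (s : R) : s != 0 -> s != 1 ->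
  clamped_uniform [set s] = 0%E.
Proof.
move=> s0 s1; rewrite /clamped_uniform /distribution /pushforward /=.
apply: (@subset_measure0 _ (measurableTypeR R) R (uniform_prob ltN12) _ [set s]) => //.
- by rewrite -[X in measurable X]setTI; exact: measurable_clamp.
- move=> x /=; rewrite /clamp => xs; move: s0 s1; rewrite -xs.
  rewrite maxEle minEle; case: (leP x 1) => x1; first by case: (leP 0 x); rewrite ?eqxx.
  by rewrite ler01 eqxx.
- exact: integral_set1.
Qed.

Lemma clamped_uniform01 : clamped_uniform `[0, 1]%classic = 1%E.
Proof.
rewrite /clamped_uniform /distribution /pushforward /=.
rewrite (_ : _ @^-1` _ = setT) ?probability_setT//.
by apply/seteqP; split => // x _ /=; rewrite in_itv /=; exact: clamp01.
Qed.

End ClampedUniform.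

(** * Differentiation of complex functions of a real variable *)

Section ComplexDerivative.
Context {R : realType}.
Implicit Types (f g : R -> R[i]) (x : R) (df dg : R[i]).
Local Notation leb := (@lebesgue_measure R).

Definition cderive f x df :=
  is_derive x 1 (fun t => Re (f t) : R^o) (Re df) /\
  is_derive x 1 (fun t => Im (f t) : R^o) (Im df).

Lemma cderive_eq f x df dg : cderive f x df -> df = dg -> cderive f x dg.
Proof. by move=> h <-. Qed.

Lemma cderive_cst (c : R[i]) x : cderive (fun=> c) x 0.
Proof. by split; exact: is_derive_cst. Qed.

Lemma cderive_real (r : R -> R) x dr :
  is_derive x 1 (r : R -> R^o) dr -> cderive (fun t => (r t)%:C%C) x dr%:C%C.
Proof. by move=> h; split => //=; exact: is_derive_cst. Qed.

Lemma cderiveD f g x df dg : cderive f x df -> cderive g x dg ->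
  cderive (fun t => f t + g t) x (df + dg).
Proof.
move=> [f1 f2] [g1 g2]; split.
  under eq_fun do rewrite cReD; rewrite cReD; exact: is_deriveD.
under eq_fun do rewrite cImD; rewrite cImD; exact: is_deriveD.
Qed.

Lemma cderiveM f g x df dg : cderive f x df -> cderive g x dg ->
  cderive (fun t => f t * g t) x (df * g x + f x * dg).
Proof.
move=> [f1 f2] [g1 g2]; split.
  under eq_fun do rewrite cReM.
  apply: is_derive_eq (is_deriveB (is_deriveM f1 g1) (is_deriveM f2 g2)) _.
  by rewrite cReD !cReM /GRing.scale /=; ring.
under eq_fun do rewrite cImM.
apply: is_derive_eq (is_deriveD (is_deriveM f1 g2) (is_deriveM f2 g1)) _.
by rewrite cImD !cImM /GRing.scale /=; ring.
Qed.

Lemma cderiveX f x df n : cderive f x df ->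
  cderive (fun t => f t ^+ n.+1) x (n.+1%:R * f x ^+ n * df).
Proof.
move=> hf; elim: n => [|n IH].
  under eq_fun do rewrite expr1.
  by apply: cderive_eq hf _; rewrite expr0 !mul1r.
under eq_fun do rewrite exprS.
apply: cderive_eq (cderiveM hf IH) _.
by rewrite [in RHS]mulrS [f x ^+ n.+1]exprS; ring.
Qed.

(** The inverse is the conjugate divided by the squared modulus [N], a nonvanishing real function at
    [x], so real differentiation rules suffice. *)
Lemma cderiveV f x df : f x != 0 -> cderive f x df ->
  cderive (fun t => (f t)^-1) x (- df * (f x)^-1 ^+ 2).
Proof.
move=> fx0 [f1 f2].
pose N t := Re (f t) * Re (f t) + Im (f t) * Im (f t).
have N0 : N x != 0.
  rewrite /N -!expr2 paddr_eq0 ?sqr_ge0// !sqrf_eq0; apply: contra fx0.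
  by case: (f x) => a b /= /andP[/eqP -> /eqP ->].
have hN := @is_deriveV R N x _ 1 N0 (is_deriveD (is_deriveM f1 f1) (is_deriveM f2 f2)).
have eR t : Re (f t)^-1 = Re (f t) * (N t)^-1.
  by rewrite /N; case: (f t).
have eI t : Im (f t)^-1 = - Im (f t) * (N t)^-1.
  by rewrite /N; case: (f t) => a b /=; rewrite mulNr.
split.
  under eq_fun do rewrite eR.
  apply: is_derive_eq (is_deriveM f1 hN) _.
  rewrite cReM expr2 cReM cImM eR eI; case: df f1 f2 hN => a b /= _ _ _.
  by move: N0; rewrite /GRing.scale /= /N => N0; field.
under eq_fun do rewrite eI.
apply: is_derive_eq (is_deriveM (is_deriveN f2) hN) _.
rewrite cImM expr2 cReM cImM eR eI; case: df f1 f2 hN => a b /= _ _ _.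
by move: N0; rewrite fctE /GRing.scale /= /N => N0; field.
Qed.

Lemma is_derive_continuous (h : R -> R) x dh :
  is_derive x 1 (h : R -> R^o) dh -> {for x, continuous h}.
Proof.
by move=> [dh1 _]; apply: differentiable_continuous; exact/derivable1_diffP.
Qed.

Lemma integral_derive (h H : R -> R) :
  (forall x, 0 <= x <= 1 -> is_derive x 1 (H : R -> R^o) (h x)) ->
  (forall x, 0 <= x <= 1 -> {for x, continuous h}) ->
  \int[leb]_(x in `[0, 1]) h x = H 1 - H 0.
Proof.
move=> Hh ch; rewrite /Rintegral (@continuous_FTC2 _ h H)//.
- apply: continuous_in_subspaceT => x; rewrite inE /= in_itv /=; exact: ch.
- split.
  + by move=> x; rewrite in_itv /= => /andP[x0 x1]; case: (Hh x) => //; rewrite !ltW.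
  + apply: cvg_at_right_filter; apply: is_derive_continuous (Hh 0 _).
    by rewrite lexx ler01.
  + apply: cvg_at_left_filter; apply: is_derive_continuous (Hh 1 _).
    by rewrite lexx ler01.
- move=> x; rewrite in_itv /= => /andP[x0 x1]; rewrite derive1E.
  by apply: derive_val; apply: Hh; rewrite !ltW.
Qed.

(** The second hypothesis provides the continuity of [f] required by the fundamental theorem of
    calculus. *)
Lemma cintegral_derive f (F : R -> R[i]) :
  (forall x, 0 <= x <= 1 -> cderive F x (f x)) ->
  (forall x, 0 <= x <= 1 -> exists df, cderive f x df) ->
  cintegral leb `[0, 1] f = F 1 - F 0.
Proof.
move=> hF hf; rewrite -[F 1 - F 0]/(F 1 + - F 0).
have hR x : 0 <= x <= 1 -> {for x, continuous (fun t => Re (f t))}.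
  by move=> /hf[df [h _]]; exact: is_derive_continuous h.
have hI x : 0 <= x <= 1 -> {for x, continuous (fun t => Im (f t))}.
  by move=> /hf[df [_ h]]; exact: is_derive_continuous h.
apply: complex_ext => /=.
  by rewrite (integral_derive (fun x hx => (hF x hx).1) hR) cReD; case: (F 0).
by rewrite (integral_derive (fun x hx => (hF x hx).2) hI) cImD; case: (F 0).
Qed.

End ComplexDerivative.

(** * The integral identity on one segment *)

Section TwoPoints.
Context {R : realType}.
Implicit Types (u v z : R[i]) (s : R).
Local Notation leb := (@lebesgue_measure R).

Definition segment u v s : R[i] := (1 - s)%:C%C * u + s%:C%C * v.

Lemma phase_mulr z : phase z * z = conjc z.
Proof.
rewrite /phase; have [->|z0] := eqVneq z 0; last by rewrite divfK.
by rewrite !mulr0 rmorph0.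
Qed.

(** Eliminating [v] from the two equations leaves [(t - s) * u = 0]. *)
Lemma segment_eq0_inj u v s t : u != 0 ->
  segment u v s = 0 -> segment u v t = 0 -> s = t.
Proof.
rewrite /segment => u0 ps pt.
have : (t - s)%:C%C * u = 0.
  transitivity (t%:C%C * (((1 - s)%:C%C * u + s%:C%C * v)) -
                s%:C%C * (((1 - t)%:C%C * u + t%:C%C * v))).
    by rewrite !rmorphB !rmorph1 /=; ring.
  by rewrite ps pt !mulr0 subrr.
move=> /eqP; rewrite mulf_eq0 (negbTE u0) orbF fmorph_eq0 subr_eq0.
by move=> /eqP.
Qed.

Lemma cmeasurable_segment_phase u v :
  cmeasurable (fun s => phase (segment u v s)).
Proof.
apply: cmeasurable_phase; apply: cmeasurableD; apply: cmeasurableM;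
  try exact: cmeasurable_cst; apply: cmeasurable_real => //.
exact: measurable_funB.
Qed.

(* With [p] the segment from [u] to [v] and [K] the phase of its direction,
   [conj p - K p] is constant along the segment, so the phase of [p] is [K + E / p].
   Then [s K + (1 - s) phase p] has derivative [- E v / p ^ 2], which makes the
   first summand of the integrand a derivative. *)
Lemma two_points u v k : u != 0 -> v != 0 ->
  let K := phase (u - v) in
  cintegral leb `[0, 1] (fun s =>
    k.+1%:R * (phase (segment u v s) - K) ^+ 2 *
      (s%:C%C * K + (1 - s)%:C%C * phase (segment u v s)) ^+ k -
    k.+1%:R * K ^+ 2 * (s%:C%C * K) ^+ k) =
  phase u ^+ k.+1 * phase v - K * phase u ^+ k.+1 - K ^+ k.+1 * phase v.
Proof.
move=> u0 v0 K; pose E := conjc u - K * u.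
(* [K * (u - v)] is the conjugate of [u - v], even for [u = v] as the phase of 0 is 0; so [E] may be
   computed from either end. *)
have Ev : E = conjc v - K * v.
  have KE : K * (u - v) = conjc u - conjc v by rewrite phase_mulr rmorphB.
  transitivity (conjc v - K * v + (conjc u - conjc v - K * (u - v))).
    by rewrite /E; ring.
  by rewrite KE subrr addr0.
have Ep s : E = conjc (segment u v s) - K * segment u v s.
  have conjZ (x : R) z : conjc (x%:C%C * z) = x%:C%C * conjc z.
    by rewrite -[in RHS](conjc_real x) -rmorphM.
  have -> : conjc (segment u v s) = (1 - s)%:C%C * conjc u + s%:C%C * conjc v.
    by rewrite -!conjZ -rmorphD.
  rewrite /segment.
  transitivity ((1 - s)%:C%C * E + s%:C%C * E).
    by rewrite -mulrDl -rmorphD /= subrK mul1r.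
  by rewrite {1}/E Ev; ring.
have phaseK w : w != 0 -> E = conjc w - K * w -> phase w = K + E * w^-1.
  by move=> w0 ->; rewrite mulrBl mulfK// addrC subrK.
have E2 : phase v - K = E * v^-1 by rewrite (phaseK v)//; ring.
pose p := segment u v.
(* [Z] is [s K + (1 - s) phase p] after substituting [phase p = K + E / p]. In the antiderivative
   [F], the factor [phase v - K = E / v] cancels the [v] in the derivative [- E v / p ^ 2] of
   [Z]. *)
pose Z s := K + (1 - s)%:C%C * (E * (p s)^-1).
pose f s := k.+1%:R * (E * (p s)^-1) ^+ 2 * Z s ^+ k -
  k.+1%:R * K ^+ 2 * (s%:C%C * K) ^+ k.
pose F s := - (phase v - K) * Z s ^+ k.+1 - K * (s%:C%C * K) ^+ k.+1.
have fE s : p s != 0 ->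
    k.+1%:R * (phase (p s) - K) ^+ 2 *
      (s%:C%C * K + (1 - s)%:C%C * phase (p s)) ^+ k -
    k.+1%:R * K ^+ 2 * (s%:C%C * K) ^+ k = f s.
  move=> ps0; rewrite /f /Z (phaseK (p s))//; congr (_ * _ ^+ 2 * _ ^+ k - _).
    by ring.
  by rewrite rmorphB rmorph1; ring.
have did s : is_derive s 1 (fun t : R => t : R^o) (1 : R^o).
  exact: is_derive_id.
have did1 s : is_derive s 1 (fun t : R => 1 - t : R^o) (- 1 : R^o).
  by apply: is_derive_eq (is_deriveB (is_derive_cst _ _ _) (did s)) _; rewrite sub0r.
have dK s := cderiveM (cderive_real (did s)) (cderive_cst K s).
have dXex (g : R -> R[i]) s dg n : cderive g s dg ->
    exists dgn, cderive (fun t => g t ^+ n) s dgn.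
  by case: n => [|n] hg; eexists; [exact: (cderive_cst 1)|exact: cderiveX hg].
(* If [E = 0], the quotient [E / p] is identically 0 and zeros of [p] do no harm; this allows one
   argument for both cases. *)
have smooth : (forall s, 0 <= s <= 1 -> E = 0 \/ p s != 0) ->
    cintegral leb `[0, 1] f = F 1 - F 0.
  move=> hp.
  have dY s : 0 <= s <= 1 ->
      cderive (fun t => E * (p t)^-1) s (- E * (v - u) * (p s)^-1 ^+ 2).
    move=> /hp[->|ps0].
      under eq_fun do rewrite mul0r.
      by apply: cderive_eq (cderive_cst 0 s) _; rewrite oppr0 !mul0r.
    have dp : cderive p s (v - u).
      have h := cderiveD
        (cderiveM (cderive_real (did1 s)) (cderive_cst u s))
        (cderiveM (cderive_real (did s)) (cderive_cst v s)).
      by apply: cderive_eq h _; rewrite rmorphN !rmorph1 !mulr0; ring.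
    apply: cderive_eq (cderiveM (cderive_cst E s) (cderiveV ps0 dp)) _.
    by ring.
  have dZ s (hs : 0 <= s <= 1) := cderiveD (cderive_cst K s)
    (cderiveM (cderive_real (did1 s)) (dY s hs)).
  apply: cintegral_derive => s hs.
    have h := cderiveD (cderiveM (cderive_cst (- (phase v - K)) s)
      (cderiveX k (dZ s hs))) (cderiveM (cderive_cst (- K) s) (cderiveX k (dK s))).
    rewrite (_ : F = fun t => - (phase v - K) * Z t ^+ k.+1 +
      - K * (t%:C%C * K) ^+ k.+1); last by apply/funext => t; rewrite /F; ring.
    apply: cderive_eq h _; rewrite E2 /f -/(Z s) !rmorphN !rmorph1 /=.
    case: (hp s hs) => [->|ps0]; first by rewrite expr2; ring.
    have hq : (1 - s)%:C%C * (v - u) = v - p s.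
      by rewrite /p /segment rmorphB rmorph1; ring.
    have -> : (1 - s)%:C%C * (- E * (v - u) * (p s)^-1 ^+ 2) =
        - E * (v - p s) * (p s)^-1 ^+ 2.
      by rewrite -hq; ring.
    move: (Z s ^+ k) (Z s ^+ k.+1) ((s%:C%C * K) ^+ k) ((s%:C%C * K) ^+ k.+1) => a b c e.
    move: (p s) ps0 (k.+1%:R : R[i]) => q q0 m.
    clearbody E K; clear -q0 v0.
    field.
    by rewrite q0 v0.
  have [dz2 hz2] := dXex _ _ _ k (dZ s hs).
  have [dk2 hk2] := dXex _ _ _ k (dK s).
  eexists; apply: (cderiveD (f := fun t => k.+1%:R * (E * (p t)^-1) ^+ 2 * Z t ^+ k)
    (g := fun t => - (k.+1%:R * K ^+ 2 * (t%:C%C * K) ^+ k))).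
    exact: cderiveM (cderiveM (cderive_cst _ s) (cderiveX 1 (dY s hs))) hz2.
  rewrite (_ : (fun t => _) = fun t => - (k.+1%:R * K ^+ 2) * (t%:C%C * K) ^+ k).
    exact: cderiveM (cderive_cst _ s) hk2.
  by apply/funext => t; rewrite mulNr.
(* [Z] runs from [phase u] at 0 to [K] at 1, and the two terms [K ^ (k + 2)] at 1 cancel. *)
have F10 : (forall s, 0 <= s <= 1 -> E = 0 \/ p s != 0) -> F 1 - F 0 =
    phase u ^+ k.+1 * phase v - K * phase u ^+ k.+1 - K ^+ k.+1 * phase v.
  have pu : phase u = K + E * (p 0)^-1.
    by rewrite /p /segment subr0 mul0r addr0 mul1r -phaseK.
  rewrite /F /Z pu subrr subr0 !rmorph0 !rmorph1 !mul0r !mul1r addr0 => _.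
  by rewrite [0 ^+ k.+1]expr0n /=; ring.
(* If the segment passes through 0, evaluating [E] there gives [E = 0]. The phase then equals [K]
   except at the single point [s0], which is Lebesgue-null. *)
have [[s0 [s01 ps0]]|ps0] := pselect (exists s, 0 <= s <= 1 /\ p s = 0).
  have E0 : E = 0 by rewrite (Ep s0) -/(p s0) ps0 rmorph0 mulr0 subrr.
  have hE0 s : 0 <= s <= 1 -> E = 0 \/ p s != 0 by left.
  have ms : cmeasurable (fun s => s%:C%C) by exact: cmeasurable_real.
  have ms1 : cmeasurable (fun s => (1 - s)%:C%C).
    by apply: cmeasurable_real; exact: measurable_funB.
  have mconst : cmeasurable (fun s => - (k.+1%:R * K ^+ 2 * (s%:C%C * K) ^+ k)).
    apply: cmeasurableN; apply: cmeasurableM; first exact: cmeasurable_cst.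
    by apply: cmeasurableX; apply: cmeasurableM => //; exact: cmeasurable_cst.
  have mg : cmeasurable (fun s => k.+1%:R * (phase (p s) - K) ^+ 2 *
      (s%:C%C * K + (1 - s)%:C%C * phase (p s)) ^+ k -
      k.+1%:R * K ^+ 2 * (s%:C%C * K) ^+ k).
    have mp := cmeasurable_segment_phase u v.
    apply: cmeasurableD => //; apply: cmeasurableM.
      apply: cmeasurableM; first exact: cmeasurable_cst.
      by apply: cmeasurableX; apply: cmeasurableD => //; exact: cmeasurable_cst.
    apply: cmeasurableX; apply: cmeasurableD; apply: cmeasurableM => //.
  rewrite -(F10 hE0) -(smooth hE0).
  apply: (@ae_eq_cintegral _ _ _ leb _ _ [set s0]) => //.
  - rewrite (_ : f = fun s => - (k.+1%:R * K ^+ 2 * (s%:C%C * K) ^+ k)).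
      exact: mconst.
    by apply/funext => s; rewrite /f E0 mul0r expr2 !mul0r mulr0 mul0r add0r.
  - exact: lebesgue_measure_set1.
  - move=> s _ ss0; apply: fE; apply/eqP => ps; apply: ss0.
    exact: segment_eq0_inj ps ps0.
have hp s : 0 <= s <= 1 -> E = 0 \/ p s != 0.
  by move=> s01; right; apply/eqP => ps; apply: ps0; exists s.
rewrite -(F10 hp) -(smooth hp); apply: eq_cintegral => s; rewrite /= in_itv /= => s01.
by apply: fE; case: (hp _ s01) => // _; apply/eqP => ps; apply: ps0; exists s.
Qed.

End TwoPoints.

(** * Expansion of the segment identity in powers of the phase *)

Section WeightPolynomial.
Context {R : realType}.
Local Notation leb := (@lebesgue_measure R).
Implicit Types (s : R) (K P u v : R[i]).

(** The first summand of the integrand in [two_points], as a polynomial in the phase; its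
    coefficients become densities. *)
Definition weight_poly k s K : {poly R[i]} :=
  (k.+1%:R)%:P * (('X - K%:P) ^+ 2 *
    ((s%:C%C * K)%:P + ((1 - s)%:C%C)%:P * 'X) ^+ k).

Lemma horner_weight_poly k s K P : (weight_poly k s K).[P] =
  k.+1%:R * (P - K) ^+ 2 * (s%:C%C * K + (1 - s)%:C%C * P) ^+ k.
Proof.
rewrite /weight_poly !hornerM !horner_exp !hornerD !hornerM.
by rewrite !hornerN !hornerC hornerX mulrA.
Qed.

Lemma size_weight_poly k s K : (size (weight_poly k s K) <= k.+3)%N.
Proof.
have size1 (c : R[i]) p : (size (c%:P * p)%R <= size p)%N.
  by rewrite mul_polyC size_scale_leq.
rewrite /weight_poly (leq_trans (size1 _ _))//.
rewrite (leq_trans (size_polyMleq _ _))// size_exp_XsubC /=.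
rewrite !addSn add0n !ltnS (leq_trans (size_poly_exp_leq _ _))// ltnS.
rewrite -[leqRHS]mul1n leq_mul2r; apply/orP; right.
rewrite -subn1 leq_subLR (leq_trans (size_polyD _ _))// geq_max.
rewrite (leq_trans (size_polyC_leq1 _))//=.
by rewrite (leq_trans (size1 _ _))// size_polyX.
Qed.

(** The constant coefficient is the value at [P = 0], which is the term subtracted in [two_points].
    Only powers from 1 to [k + 2] remain, and [k < m] makes room for all of them. *)
Lemma weight_poly_sum k s K P m : (k < m)%N ->
  \sum_(j < m.+1) (weight_poly k s K)`_j.+1 * P ^+ j.+1 =
  k.+1%:R * (P - K) ^+ 2 * (s%:C%C * K + (1 - s)%:C%C * P) ^+ k -
  k.+1%:R * K ^+ 2 * (s%:C%C * K) ^+ k.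
Proof.
move=> km; rewrite -horner_weight_poly.
have -> : k.+1%:R * K ^+ 2 * (s%:C%C * K) ^+ k = (weight_poly k s K)`_0.
  by rewrite -horner_coef0 horner_weight_poly sub0r sqrrN mulr0 addr0.
rewrite (@horner_coef_wide _ m.+2).
  by rewrite [in RHS]big_ord_recl /= expr0 mulr1 addrC addKr.
by rewrite (leq_trans (size_weight_poly _ _ _)).
Qed.

Lemma ubm_weight_poly d (T : measurableType d) (W : Type) k
    (s : T -> R) (K : W -> T -> R[i]) j :
  measurable_fun setT s -> (forall x, 0 <= s x <= 1) -> ubm K ->
  ubm (fun w x => (weight_poly k (s x) (K w x))`_j).
Proof.
move=> ms s01 bK.
(* Boundedness is propagated coefficientwise: a coefficient of a product is a finite sum of products
   of coefficients. *)
pose ubmp (F : W -> T -> {poly R[i]}) := forall i, ubm (fun w x => (F w x)`_i).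
have ubmpM F G : ubmp F -> ubmp G -> ubmp (fun w x => F w x * G w x).
  move=> bF bG i; under eq_fun do under eq_fun do rewrite coefM.
  by apply: ubm_sum => l; exact: ubmM.
have ubmpX F n : ubmp F -> ubmp (fun w x => F w x ^+ n).
  move=> bF; elim: n => [|n IH].
    move=> i; under eq_fun do under eq_fun do rewrite expr0.
    exact: ubm_const.
  by under eq_fun do under eq_fun do rewrite exprS; exact: ubmpM.
have ubmpD F G : ubmp F -> ubmp G -> ubmp (fun w x => F w x + G w x).
  move=> bF bG i; under eq_fun do under eq_fun do rewrite coefD.
  exact: ubmD.
have ubmpC F : ubm F -> ubmp (fun w x => (F w x)%:P).
  move=> bF i; under eq_fun do under eq_fun do rewrite coefC.
  case: (i == 0)%N => //; exact: ubm_const.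
have ubmpcst (p : {poly R[i]}) : ubmp (fun _ _ => p).
  by move=> i; exact: ubm_const.
have bunit (r : T -> R) : measurable_fun setT r -> (forall x, 0 <= r x <= 1) ->
    ubm (fun (_ : W) x => (r x)%:C%C).
  move=> mr r01; split=> [|w]; last exact: cmeasurable_real.
  exists 1 => w x; rewrite normc_ReIm /= expr0n addr0 sqrtr_sqr ger0_norm.
    by have /andP[] := r01 x.
  by have /andP[] := r01 x.
have b1s : ubm (fun (_ : W) x => (1 - s x)%:C%C).
  apply: bunit => [|x]; first exact: measurable_funB.
  have /andP[s0 s1] := s01 x; rewrite subr_ge0 s1 /= lerBlDr lerDl//.
have bs : ubm (fun (_ : W) x => (s x)%:C%C) by exact: bunit.
rewrite (_ : (fun w x => _) = fun w x =>
  ((k.+1%:R)%:P * (('X + (-1)%:P * (K w x)%:P) ^+ 2 *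
  (((s x)%:C%C * K w x)%:P + ((1 - s x)%:C%C)%:P * 'X) ^+ k))`_j).
  apply: (ubmpM _ _ (ubmpcst _)).
  apply: (ubmpM _ _); apply: (ubmpX _ _); apply: (ubmpD _ _).
  - exact: ubmpcst.
  - by apply: (ubmpM _ _ (ubmpcst _)); exact: ubmpC.
  - by apply: ubmpC; exact: ubmM.
  - by apply: (ubmpM _ _ _ (ubmpcst _)); exact: ubmpC.
apply/funext => w; apply/funext => x.
by rewrite /weight_poly rmorphN rmorph1 mulN1r.
Qed.

(** The coefficients are bounded only for parameters in a bounded range; clamping ensures this and
    changes nothing on [0, 1]. *)
Lemma bm_weight_poly k j K : bm (fun s => (weight_poly k (clamp s) K)`_j).
Proof.
have := @ubm_weight_poly _ R unit k clamp (fun _ _ => K) j measurable_clamp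
  (@clamp01 R) (ubm_const unit K).
exact: (ubm_bm tt).
Qed.

(* [H j] is the density attached to the j+1-st power on the segment; the factors
   3 undo the masses 1/3 of [clamped_uniform]. *)
Lemma cintegral_segment (n : nat) (a : nat -> R[i]) (c u v : R[i]) :
  u != 0 -> v != 0 ->
  let K := phase (u - v) in
  let H j s := if s == 1 then 3%:R * ((j == 0)%:R * c)
    else if s == 0 then 3%:R * (if (j < n)%N then K * a j else 0)
    else 3%:R * \sum_(k < n) a k * (weight_poly k (clamp s) K)`_j.+1 in
  cintegral clamped_uniform setT (fun s =>
    \sum_(j < n.+1) phase (segment u v s) ^+ j.+1 * H j s) =
  (\sum_(k < n) phase u ^+ k.+1 * a k) * phase v -
  (\sum_(k < n) K ^+ k.+1 * a k) * phase v + c * phase v.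
Proof.
move=> u0 v0 K H.
have bP : bm (fun s => phase (segment u v s)).
  by have [mP1 mP2] := cmeasurable_segment_phase u v; split => //; exists 1 => s;
     exact: normc_phase_le1.
pose B j s := 3%:R * \sum_(k < n) a k * (weight_poly k (clamp s) K)`_j.+1.
have bB j : bm (B j).
  apply: bmM; first exact: bm_cst.
  by apply: bm_sum => k; apply: bmM; [exact: bm_cst|exact: bm_weight_poly].
have bH j : bm (H j).
  suff : ubm (fun (_ : unit) => H j) by exact: (ubm_bm tt).
  apply: ubm_if; first by apply: measurable_fun_eqr => //; exact: measurable_cst.
    exact/bm_ubm/bm_cst.
  apply: ubm_if; first by apply: measurable_fun_eqr => //; exact: measurable_cst.
    exact/bm_ubm/bm_cst.
  exact/bm_ubm/bB.
have bPH j : bm (fun s => phase (segment u v s) ^+ j.+1 * H j s).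
  by apply: bmM => //; exact: bmX.
have bPB j : bm (fun s => phase (segment u v s) ^+ j.+1 * B j s).
  by apply: bmM => //; exact: bmX.
have lab : (leb `[0%R, 1%R]%classic < +oo)%E.
  by rewrite lebesgue_measure_itv /= lte01 oppr0 adde0 ltry.
pose f s := \sum_(j < n.+1) phase (segment u v s) ^+ j.+1 * H j s.
pose A := \sum_(k < n) phase u ^+ k.+1 * a k.
pose B0 := \sum_(k < n) K ^+ k.+1 * a k.
(* The atom at 0 is designed to cancel the term [- K * A] coming from [two_points]. *)
have f0 : f 0 = 3%:R * (K * A).
  rewrite /f /segment subr0 rmorph0 rmorph1 mul1r mul0r addr0.
  rewrite /H eq_sym oner_eq0 eqxx big_ord_recr /= ltnn !mulr0 addr0 !mulr_sumr.
  by apply: eq_bigr => j _; rewrite ltn_ord; ring.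
(* The atom at 1 feeds the first power alone and leaves [c] free; the induction chooses [c] to
   compensate [B0] on average. *)
have f1 : f 1 = 3%:R * (c * phase v).
  rewrite /f /segment subrr rmorph0 rmorph1 mul1r mul0r add0r.
  rewrite /H eqxx big_ord_recl /= expr1 mul1r big1 ?addr0; first by ring.
  by move=> j _; rewrite mul0r !mulr0.
have fI : cintegral leb `[0, 1] f =
    3%:R * \sum_(k < n) a k * (phase u ^+ k.+1 * phase v -
      K * phase u ^+ k.+1 - K ^+ k.+1 * phase v).
  transitivity (cintegral leb `[0, 1] (fun s => 3%:R * \sum_(k < n) a k *
      \sum_(j < n.+1) (weight_poly k (clamp s) K)`_j.+1 *
        phase (segment u v s) ^+ j.+1)).
    (* For Lebesgue measure the endpoints are null, so [H] may be replaced by its interior formula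
       [B]. *)
    transitivity (cintegral leb `[0, 1] (fun s =>
        \sum_(j < n.+1) phase (segment u v s) ^+ j.+1 * B j s)).
      have mPH := (bm_sum (index_enum 'I_n.+1) bPH).2.
      have mPB := (bm_sum (index_enum 'I_n.+1) bPB).2.
      apply: (ae_eq_cintegral (mu := leb) (N := [set 0] `|` [set 1]) _ mPH mPB).
      - exact: measurable_itv.
      - by apply: measurableU.
      - apply/eqP; rewrite -measure_le0.
        by rewrite (le_trans (measureU2 _ _ _))//= !lebesgue_measure_set1 adde0.
      - move=> s _ /not_orP[/= /eqP/negbTE s0 /eqP/negbTE s1].
        by apply: eq_bigr => j _; rewrite /H s0 s1.
    apply: eq_cintegral => s _; rewrite /B.
    rewrite mulr_sumr; under eq_bigr do rewrite mulrCA mulr_sumr mulr_sumr.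
    rewrite exchange_big /=; apply: eq_bigr => k _.
    by rewrite !mulr_sumr; apply: eq_bigr => j _; ring.
  have bS (k : 'I_n) : bm (fun s =>
      \sum_(j < n.+1) (weight_poly k (clamp s) K)`_j.+1 *
        phase (segment u v s) ^+ j.+1).
    apply: bm_sum => j; apply: bmM; first exact: bm_weight_poly.
    exact: bmX.
  have baS (k : 'I_n) : bm (fun s =>  a k *
      \sum_(j < n.+1) (weight_poly k (clamp s) K)`_j.+1 *
        phase (segment u v s) ^+ j.+1).
    by apply: bmM => //; exact: bm_cst.
  rewrite cintegralZl//; last exact: bm_sum.
  rewrite cintegral_sum//; congr (_ * _); apply: eq_bigr => k _.
  rewrite cintegralZl//; last exact: bS.
  congr (_ * _); rewrite -two_points//.
  apply: eq_cintegral => s; rewrite /= in_itv /= => /andP[s0 s1].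
  rewrite -(weight_poly_sum _ _ _ (ltn_ord k)).
  by rewrite /clamp min_l// max_r.
have S : \sum_(k < n) a k * (phase u ^+ k.+1 * phase v -
    K * phase u ^+ k.+1 - K ^+ k.+1 * phase v) =
    A * phase v - K * A - B0 * phase v.
  rewrite /A /B0 !mulr_suml mulr_sumr -!sumrB.
  by apply: eq_bigr => k _; ring.
rewrite -/f cintegral_clamped_uniform; last exact: bm_sum.
rewrite f0 f1 fI S -/A -/B0 -!mulrDr mulrAC divff ?pnatr_eq0// mul1r.
ring.
Qed.

End WeightPolynomial.

(** * The simplex as a cone over the simplex of one dimension less *)

Section Cone.
Context {R : realType}.

(** The apex is the new vertex [ord0] and [x.2] is its weight: the image is the point at parameter
    [x.2] on the segment from the base point [x.1] to the apex. *)
Definition cone n (x : n.-tuple R * R) : n.+1.-tuple R :=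
  [tuple of x.2 :: [tuple (1 - x.2) * tnth x.1 i | i < n]].

(* The base of the cone is recovered by dividing by [1 - s], hence not at the
   apex [s = 1], where division by 0 gives the zero tuple. *)
Definition uncone n (t : n.+1.-tuple R) : n.-tuple R * R :=
  ([tuple tnth t (lift ord0 i) / (1 - tnth t ord0) | i < n], tnth t ord0).

Lemma tnth_cone0 n (x : n.-tuple R * R) : tnth (cone x) ord0 = x.2.
Proof. by []. Qed.

Lemma tnth_coneS n (x : n.-tuple R * R) i :
  tnth (cone x) (lift ord0 i) = (1 - x.2) * tnth x.1 i.
Proof. by rewrite tnthS tnth_mktuple. Qed.

Lemma coneK n (x : n.-tuple R * R) : x.2 != 1 -> uncone (cone x) = x.
Proof.
case: x => t s /= s1; rewrite /uncone tnth_cone0; congr pair.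
apply: eq_from_tnth => i; rewrite tnth_mktuple tnth_coneS /=.
by rewrite mulrAC divff ?mul1r// subr_eq0 eq_sym.
Qed.

Lemma measurable_cone n :
  measurable_fun [set: (n.-tuple R * R)%type] (@cone n).
Proof.
apply/measurable_fun_tnthP => i; case: (unliftP ord0 i) => [j|] ->.
  rewrite (_ : _ \o _ = fun x => (1 - x.2) * tnth x.1 j).
    apply: measurable_funM; first exact: measurable_funB.
    exact: measurableT_comp (measurable_tnth j) measurable_fst.
  by apply/funext => x /=; rewrite tnth_coneS.
exact: measurable_snd.
Qed.

Lemma measurable_uncone n : measurable_fun setT (@uncone n).
Proof.
apply: measurable_fun_pair; last exact: measurable_tnth.
apply/measurable_fun_tnthP => i.
rewrite (_ : _ \o _ = fun t => tnth t (lift ord0 i) * (1 - tnth t ord0)^-1).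
  apply: measurable_funM; first exact: measurable_tnth.
  apply: (measurableT_comp (@measurable_invr R)).
  by apply: measurable_funB => //; exact: measurable_tnth.
by apply/funext => t /=; rewrite tnth_mktuple.
Qed.

Lemma simplex_cone n (x : n.-tuple R * R) :
  simplex x.1 -> 0 <= x.2 <= 1 -> simplex (cone x).
Proof.
move=> [x0 x1] /andP[s0 s1]; split.
  move=> i; case: (unliftP ord0 i) => [j|] ->//.
  by rewrite tnth_coneS mulr_ge0// subr_ge0.
rewrite big_ord_recl tnth_cone0.
under eq_bigr do rewrite tnth_coneS.
by rewrite -mulr_sumr x1 mulr1 addrC subrK.
Qed.

(** Over a fixed base point the cone traces a segment, which reduces the induction step to the
    two-point identity. *)
Lemma lincomb_cone n (x : n.-tuple R * R) (w : 'I_n.+1 -> R[i]) z :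
  z - lincomb (cone x) w =
  segment (z - lincomb x.1 (w \o lift ord0)) (z - w ord0) x.2.
Proof.
rewrite /lincomb /segment big_ord_recl tnth_cone0.
under eq_bigr do rewrite tnth_coneS rmorphM -mulrA.
by rewrite -mulr_sumr /= rmorphB rmorph1; ring.
Qed.

Lemma cmeasurable_lincomb n (w : 'I_n -> R[i]) :
  cmeasurable (fun t : n.-tuple R => lincomb t w).
Proof.
apply: cmeasurable_sum => i; apply: cmeasurableM; last exact: cmeasurable_cst.
by apply: cmeasurable_real; exact: measurable_tnth.
Qed.

Lemma measurable_fiber d (T : measurableType d) (f : T -> R[i]) z :
  cmeasurable f -> measurable [set t | f t = z].
Proof.
move=> [f1 f2].
have -> : [set t | f t = z] = (fun t => Re (f t)) @^-1` [set Re z] `&`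
    (fun t => Im (f t)) @^-1` [set Im z].
  apply/seteqP; split => [t /= -> //|t /= []]; exact: complex_ext.
apply: measurableI; rewrite -[X in measurable X]setTI.
  exact: f1.
exact: f2.
Qed.

Lemma measurable_simplex n : measurable (@simplex R n).
Proof.
have -> : @simplex R n = (\bigcap_(i in [set: 'I_n]) [set t | 0 <= tnth t i]) `&`
    (fun t => \sum_(i < n) tnth t i) @^-1` [set 1].
  apply/seteqP; split => [t [t0 t1]|t [t0 t1]]; split => //= i.
    by move=> _; exact: t0.
  exact: t0.
apply: measurableI.
  apply: fin_bigcap_measurable => // i _.
  rewrite -[X in measurable X]setTI.
  rewrite (_ : [set t | _] = (@tnth _ R ^~ i) @^-1` `[0, +oo[%classic).
    exact: measurable_tnth.
  by apply/seteqP; split => t /=; rewrite in_itv /= andbT.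
rewrite -[X in measurable X]setTI.
by apply: measurable_sum => // i; exact: measurable_tnth.
Qed.

End Cone.

(** * Existence of the representation, by induction on the number of points *)

Section Representation.
Context {R : realType}.

Lemma ubm_cintegral d d' (T : measurableType d) (T' : measurableType d')
    (P : probability T R) (W : Type) (F : W -> T -> R[i]) :
  ubm F -> ubm (fun w (_ : T') => cintegral P setT (F w)).
Proof.
move=> bF; have [[M hM] _] := bF; apply: (ubm_cst (M := M + M)) => w.
by apply: normc_cintegral_le => //; exact: ubm_bm bF.
Qed.

(** The induction invariant: [nu] is fixed before the points, which enter only through uniformly
    bounded densities. The null set clause lets the step discard base points with
    [z - lincomb t w = 0]. *)
Definition phase_representation n (nu : probability (n.-tuple R) R)
    (h : nat -> ('I_n -> R[i]) -> n.-tuple R -> R[i]) :=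
  [/\ nu (@simplex R n) = 1%E,
      forall k, ubm (h k) &
      forall w z, (forall j, z != w j) ->
        nu [set t | lincomb t w = z] = 0%E /\
        phase (\prod_(j < n) (z - w j)) =
        \sum_(k < n) cintegral nu setT
          (fun t => phase (z - lincomb t w) ^+ k.+1 * h k w t)].

(** The simplex is a single point, carrying a Dirac mass with density 1. *)
Lemma phase_representation1 :
  exists nu h, @phase_representation 1 nu h.
Proof.
pose e : 1.-tuple R := [tuple 1].
have eE w : lincomb e w = w ord0.
  by rewrite /lincomb big_ord1 (tnth_nth 0) /= rmorph1 mul1r.
exists (dirac e), (fun _ _ _ => 1); split.
- rewrite /= diracE mem_set//; split => [i|].
    by rewrite ord1 (tnth_nth 0).
  by rewrite big_ord1 (tnth_nth 0).
- by move=> k; exact: ubm_const.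
move=> w z zw; split.
  rewrite /= diracE memNset//= eE => ez.
  by have := zw ord0; rewrite ez eqxx.
rewrite !big_ord1.
have bf : bm (fun t : 1.-tuple R => phase (z - lincomb t w) ^+ 1 * 1).
  apply: bmM; last exact: bm_cst.
  apply: bmX; apply: bm_phase; apply: cmeasurableD; first exact: cmeasurable_cst.
  by apply: cmeasurableN; exact: cmeasurable_lincomb.
have [m1 m2] := bf.2.
rewrite -[LHS](mulr1) -[phase (z - w ord0)]expr1 -eE.
apply: complex_ext; rewrite /= /Rintegral integral_dirac// ?diracT ?mul1e//;
exact/measurable_EFinP.
Qed.

(** The product of [nu] with the clamped uniform law is pushed forward along the cone. Over a base
    point [t], [cintegral_segment] gives the wanted product plus an error proportional to [phase v],
    whose mean over [t] vanishes by the choice of [c]. *)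
Lemma phase_representationS n nu h : @phase_representation n nu h ->
  exists nu' h', @phase_representation n.+1 nu' h'.
Proof.
move=> [nuS bh rep].
pose rho := @clamped_uniform R.
pose nu' : probability (n.+1.-tuple R) R :=
  distribution (nu \x rho)%E (mfun_of (@measurable_cone R n)).
pose K (w : 'I_n.+1 -> R[i]) (t : n.-tuple R) :=
  phase (w ord0 - lincomb t (w \o lift ord0)).
have bK : ubm K.
  apply: ubm_phase => w; apply: cmeasurableD; first exact: cmeasurable_cst.
  by apply: cmeasurableN; exact: cmeasurable_lincomb.
have bh' k : ubm (fun (w : 'I_n.+1 -> R[i]) t => h k (w \o lift ord0) t).
  exact: (@ubm_comp _ _ _ _ _ _ _ (h k) (fun w => w \o lift ord0) id).
pose a w t k := h k (w \o lift ord0) t.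
(* All points [(t, 1)] have the same image under [cone], so that the density there
   cannot depend on [t]: it is replaced by its mean. *)
pose c w := \sum_(k < n) cintegral nu setT (fun t => K w t ^+ k.+1 * a w t k).
pose H j w (x : n.-tuple R * R) :=
  if x.2 == 1 then 3%:R * ((j == 0)%:R * c w)
  else if x.2 == 0 then 3%:R * (if (j < n)%N then K w x.1 * a w x.1 j else 0)
  else 3%:R * \sum_(k < n) a w x.1 k * (weight_poly k (clamp x.2) (K w x.1))`_j.+1.
have meq (r : R) : measurable_fun [set: (n.-tuple R * R)%type] (fun x => x.2 == r).
  by apply: measurable_fun_eqr => //; exact: measurable_cst.
have bfst (F : ('I_n.+1 -> R[i]) -> n.-tuple R -> R[i]) : ubm F ->
    ubm (fun w (x : n.-tuple R * R) => F w x.1).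
  by move=> bF; exact: (@ubm_comp _ _ _ _ _ _ _ F id fst).
have bH j : ubm (H j).
  apply: ubm_if => //; last apply: ubm_if => //.
  - apply: ubmM; first exact: ubm_const.
    apply: ubmM; first exact: ubm_const.
    apply: ubm_sum => k; apply: ubm_cintegral.
    by apply: ubmM; [exact: ubmX|exact: bh'].
  - apply: ubmM; first exact: ubm_const.
    case: (j < n)%N; last exact: ubm_const.
    by apply: (bfst (fun w t => K w t * a w t j)); apply: ubmM; [|exact: bh'].
  - apply: ubmM; first exact: ubm_const.
    apply: ubm_sum => k; apply: ubmM; first exact: (bfst _ (bh' k)).
    apply: ubm_weight_poly => [|x|]; last exact: (bfst K).
      exact: measurableT_comp measurable_clamp measurable_snd.
    exact: clamp01.
(* At the apex [uncone] loses the base point, but there [H] depends on [w] and [j] only. *)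
have HK j w x : H j w (uncone (cone x)) = H j w x.
  have [x1|x1] := eqVneq x.2 1; last by rewrite coneK.
  by rewrite /H /= tnth_cone0 x1 eqxx.
exists nu', (fun j w t => H j w (uncone t)); split.
- apply/eqP; rewrite eq_le probability_le1/=; last exact: measurable_simplex.
  have <- : (nu \x rho)%E (@simplex R n `*` `[0, 1]%classic) = 1%E.
    rewrite product_measure1E//; last exact: measurable_simplex.
    by rewrite [X in (X * _)%E]nuS [X in (_ * X)%E]clamped_uniform01 mule1.
  apply: le_measure; rewrite ?inE.
  + by apply: measurableX => //; exact: measurable_simplex.
  + rewrite -[X in measurable X]setTI; apply: measurable_cone => //.
    exact: measurable_simplex.
  + by move=> x [xs]; rewrite /= in_itv /=; exact: simplex_cone.
- by move=> k; exact: (@ubm_comp _ _ _ _ _ _ _ (H k) id (@uncone R n)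
    (@measurable_uncone R n)).
move=> w z zw.
have zw' j : z != (w \o lift ord0) j by exact: zw.
have [nu0 rep1] := rep _ _ zw'.
pose u t := z - lincomb t (w \o lift ord0).
pose v := z - w ord0.
have v0 : v != 0 by rewrite subr_eq0.
have mnull : measurable [set t : n.-tuple R | lincomb t (w \o lift ord0) = z].
  by apply: measurable_fiber; exact: cmeasurable_lincomb.
have u0 t : ~ lincomb t (w \o lift ord0) = z -> u t != 0.
  by move=> h0; rewrite subr_eq0; apply/eqP => h1; apply: h0.
have mA : measurable [set x : n.-tuple R * R | lincomb (cone x) w = z].
  apply: measurable_fiber.
  exact: cmeasurable_comp (@measurable_cone R n) (cmeasurable_lincomb w).
split.
  (* By Fubini it suffices to treat base points with [u t != 0]. The segment from [u t] to [v] then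
     vanishes at most once, and not at 0 or 1, so it avoids the atoms. *)
  rewrite /nu' /distribution /pushforward /= /product_measure1.
  rewrite (ae_eq_integral (cst 0%E)) ?integral0//.
    exact: measurable_fun_xsection.
  exists [set t : n.-tuple R | lincomb t (w \o lift ord0) = z]; split => // t /= ht.
  apply: contrapT => tz; apply: ht => _.
  have ut := u0 _ tz.
  have secE s : xsection (@cone R n @^-1` [set t | lincomb t w = z]) t s <->
      segment (u t) v s = 0.
    have -> : segment (u t) v s = z - lincomb (cone (t, s)) w.
      by rewrite lincomb_cone.
    rewrite /xsection /= inE /=; split => [->|/eqP]; first by rewrite subrr.
    by rewrite subr_eq0 => /eqP.
  have [[s hs]|hs] := pselect (exists s, segment (u t) v s = 0); last first.
    rewrite (_ : xsection _ t = set0) ?measure0//.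
    by apply/seteqP; split => // s /secE hs0; apply: hs; exists s.
  rewrite (_ : xsection _ t = [set s]).
    apply: clamped_uniform_set1; apply/eqP => s0; move: hs; rewrite s0.
      rewrite /segment subr0 rmorph0 rmorph1 mul1r mul0r addr0 => /eqP.
      by rewrite (negbTE ut).
    rewrite /segment subrr rmorph0 rmorph1 mul1r mul0r add0r => /eqP.
    by rewrite (negbTE v0).
  apply/seteqP; split => [s' /secE hs'|s' ->]; last exact/secE.
  exact: segment_eq0_inj ut hs' hs.
have bP : bm (fun t : n.+1.-tuple R => phase (z - lincomb t w)).
  apply: bm_phase; apply: cmeasurableD; first exact: cmeasurable_cst.
  by apply: cmeasurableN; exact: cmeasurable_lincomb.
have bu : bm (fun t => phase (u t)).
  apply: bm_phase; apply: cmeasurableD; first exact: cmeasurable_cst.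
  by apply: cmeasurableN; exact: cmeasurable_lincomb.
have bPH j : bm (fun x => phase (segment (u x.1) v x.2) ^+ j.+1 * H j w x).
  apply: bmM; last exact: ubm_bm (bH j).
  apply: bmX; rewrite (_ : (fun _ => _) = fun x => phase (z - lincomb (cone x) w)).
    exact: bm_comp (@measurable_cone R n) bP.
  by apply/funext => x; rewrite lincomb_cone.
have ba k : bm (fun t => a w t k) := ubm_bm w (bh' k).
have bua (k : 'I_n) : bm (fun t => phase (u t) ^+ k.+1 * a w t k).
  by apply: bmM => //; exact: bmX.
have bKa (k : 'I_n) : bm (fun t => K w t ^+ k.+1 * a w t k).
  by apply: bmM => //; apply: bmX; exact: ubm_bm bK.
have P1 := probability_lty nu.
have PP := probability_lty (nu \x rho)%E.
rewrite big_ord_recl phaseM rep1.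
transitivity (cintegral (nu \x rho)%E setT (fun x => \sum_(j < n.+1)
    phase (segment (u x.1) v x.2) ^+ j.+1 * H j w x)); last first.
  rewrite cintegral_sum//; apply: eq_bigr => j _.
  rewrite cintegral_distribution/=.
    by apply: eq_cintegral => x _; rewrite HK lincomb_cone.
  apply: bmM; first exact: bmX.
  exact: bm_comp (@measurable_uncone R n) (ubm_bm w (bH j)).
rewrite cintegral_prod; last exact: bm_sum.
have bG := bm_cintegral2 nu rho (bm_sum (index_enum 'I_n.+1) bPH).
have bS1 : bm (fun t => \sum_(k < n) phase (u t) ^+ k.+1 * a w t k).
  exact: bm_sum.
have bS2 : bm (fun t => \sum_(k < n) K w t ^+ k.+1 * a w t k) by exact: bm_sum.
have b1 := bmM bS1 (bm_cst (phase v)).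
have b2 := bmM (bm_cst (- phase v)) bS2.
have b3 := bm_cst (T := n.-tuple R) (c w * phase v).
have b12 := bmD b1 b2.
(* For almost every [t] the point [u t] is nonzero and the segment identity applies; [z] cancels in
   [u t - v], so its phase is [K w t]. *)
rewrite (ae_eq_cintegral measurableT bG.2 (bmD b12 b3).2 mnull nu0); last first.
  move=> t _ /u0 ut.
  have KE : K w t = phase (u t - v).
    by rewrite /K /u /v; congr phase; ring.
  rewrite mulNr [phase v * _]mulrC KE -(cintegral_segment n (a w t) (c w) ut v0) -KE.
  by apply: eq_cintegral => s _.
rewrite (cintegralD measurableT P1 b12 b3) (cintegralD measurableT P1 b1 b2).
rewrite (cintegralZr measurableT P1 _ bS1) (cintegralZl measurableT P1 _ bS2).
rewrite cintegral_probability_cst.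
rewrite (cintegral_sum measurableT P1 _ bua) (cintegral_sum measurableT P1 _ bKa).
(* By definition of [c w], the last two terms cancel. *)
by rewrite mulNr [X in _ - X + _]mulrC subrK; exact: mulrC.
Qed.

Lemma phase_representation_exists n : exists nu h, @phase_representation n.+1 nu h.
Proof.
elim: n => [|n [nu [h rep]]]; first exact: phase_representation1.
exact: phase_representationS rep.
Qed.

End Representation.

(** * Passage to the simplex and to total variations *)

Lemma measurable_cabs (R : realType) d (T : measurableType d) (f : T -> R[i]) :
  cmeasurable f -> measurable_fun setT (fun x => cabs (f x)).
Proof.
move=> [f1 f2].
apply: (measurableT_comp (continuous_measurable_fun (@sqrt_continuous R))).
by apply: measurable_funD; exact: measurable_funX.
Qed.

Lemma cintegral_full (R : realType) d (T : measurableType d)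
    (P : probability T R) (D : set T) (f : T -> R[i]) :
  measurable D -> P D = 1%E -> bm f ->
  cintegral P D f = cintegral P setT f.
Proof.
move=> mD PD bf.
have [i1 i2] := bm_cintegrable measurableT (probability_lty P) bf.
have mDC : measurable (~` D) by exact: measurableC.
have PDC : P (~` D) = 0%E by rewrite probability_setC// PD subee.
apply: complex_ext => /=; congr fine.
  by rewrite [RHS](negligible_integral mDC _ i1)// setTD setCK.
by rewrite [RHS](negligible_integral mDC _ i2)// setTD setCK.
Qed.

Theorem theorem3p7 (R : realType) (n : nat) : (1 <= n)%N ->
  exists C : R, 0 < C /\
  forall w : 'I_n -> R[i],
  exists (nu : 'I_n -> {measure set (n.-tuple R) -> \bar R})
         (h : 'I_n -> n.-tuple R -> R[i]),
    (forall k : 'I_n,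
       cintegrable (nu k) (@simplex R n) (h k) /\
       (ctotvar (nu k) (@simplex R n) (h k) <= C%:E)%E) /\
    forall z : R[i], (forall j : 'I_n, z != w j) ->
      (forall k : 'I_n,
         ctotvar (nu k) (@simplex R n `&` [set t | lincomb t w = z]) (h k) = 0%E) /\
      phase (\prod_(j < n) (z - w j)) =
      \sum_(k < n) cintegral (nu k) (@simplex R n)
                     (fun t => phase (z - lincomb t w) ^+ k.+1 * h k t).
Proof.
case: n => // n _; have [nu [h [nuS bh rep]]] := @phase_representation_exists R n.
have mS := @measurable_simplex R n.+1.
have cabsE (x : R[i]) : cabs x = normc x by case: x.
have hM (k : 'I_n.+1) : exists M, forall w t, normc (h k w t) <= M by case: (bh k).
have {hM} [M hM] := boolp.choice hM.
(* Each [M k] bounds its density for all points at once, so the constant precedes [w]; the summand 1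
   makes it positive. Since [nu] has mass 1 on the simplex, bounds on densities are bounds on total
   variations. *)
exists (1 + \sum_(k < n.+1) `|M k|); split.
  by rewrite ltr_pwDl// sumr_ge0.
move=> w; exists (fun=> nu), (fun k => h k w); split => [k|z zw].
  have nuSy : (nu (@simplex R n.+1) < +oo)%E.
    exact: le_lt_trans (probability_le1 _ mS) (ltry 1).
  split; first exact: (bm_cintegrable mS nuSy (ubm_bm w (bh k))).
  rewrite /ctotvar; apply: (@le_trans _ _ (\int[nu]_(x in @simplex R n.+1) (M k)%:E)%E).
    apply: ge0_le_integral => //.
    - by move=> x _; rewrite lee_fin cabsE normc_ge0.
    - by apply/measurable_EFinP/measurable_funTS/measurable_cabs; exact: (bh k).2.
    - by move=> x _; rewrite lee_fin cabsE.
  rewrite integral_cst// [X in (_ * X)%E]nuS mule1 lee_fin.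
  rewrite (le_trans (ler_norm _))// ler_wpDl// (bigD1 k)//= lerDl.
  exact: sumr_ge0.
have [nu0 ->] := rep w z zw.
have mF : measurable [set t : n.+1.-tuple R | lincomb t w = z].
  by apply: measurable_fiber; exact: cmeasurable_lincomb.
split => [k|].
  apply: null_set_integral; first exact: measurableI.
    by apply/measurable_EFinP/measurable_funTS/measurable_cabs; exact: (bh k).2.
  apply: (subset_measure0 (B := [set t | lincomb t w = z])) => //.
  exact: measurableI.
apply: eq_bigr => k _.
have bf : bm (fun t => phase (z - lincomb t w) ^+ k.+1 * h k w t).
  apply: bmM; last exact: ubm_bm (bh k).
  apply: bmX; apply: bm_phase; apply: cmeasurableD; first exact: cmeasurable_cst.
  by apply: cmeasurableN; exact: cmeasurable_lincomb.
by rewrite cintegral_full.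
Qed.
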